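(* Let $f_1,f_2,\dots,f_n:X\to Y$ be maps, and let $e_n:Y^{J_n}\to Y^n$ be the fibration $e_n(\gamma)=(\gamma(1_1),\gamma(1_2),\dots,\gamma(1_n))$. Let $q:P\to X$ be the pullback of the fibration $e_n$ by the map $F=(f_1,f_2,\dots,f_n):X\to Y^n$. Then $\mathrm{D}(f_1,f_2,\dots,f_n)=\mathrm{secat}(q)$.
   Context: All maps are continuous. For maps $f_1,\dots,f_n:X\to Y$, the $n$-th homotopic distance $\mathrm{D}(f_1,\dots,f_n)$ is the least non-negative integer $k$ such that there exist open subsets $U_0,\dots,U_k$ covering $X$ with $f_1|_{U_j}\simeq f_2|_{U_j}\simeq\cdots\simeq f_n|_{U_j}$ (homotopic as maps $U_j\to Y$) for all $j\in\{0,\dots,k\}$; if no such covering exists, $\mathrm{D}(f_1,\dots,f_n)=\infty$. $J_n$ is the wedge sum of $n$ closed intervals $[0,1]_i$, $i=1,\dots,n$, where the zeros $0_i$ are all identified; $1_i$ denotes the endpoint $1$ of the $i$-th interval. $Y^{J_n}$ is the space of continuous maps $J_n\to Y$ (compact-open topology). The pullback is $P=\{(x,\gamma)\in X\times Y^{J_n} : e_n(\gamma)=F(x)\}$ with $q(x,\gamma)=x$. The sectional category $\mathrm{secat}(q)$ of a fibration $q:E\to B$ is the least integer $k\ge 0$ such that there is an open covering $\{U_0,\dots,U_k\}$ of $B$ with, for every $i$, a section $s_i:U_i\to E$ of $q$ over $U_i$ (that is, a continuous map with $q\circ s_i$ equal to the inclusion $U_i\hookrightarrow B$); it is $\infty$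 if no such covering exists. *)

(* Defs.v *)
From HB Require Import structures.
From mathcomp Require Import all_boot all_order all_algebra.
From mathcomp Require Import boolp classical_sets functions reals topology.
From mathcomp Require Import normedtype wedge_sigT.

Set Implicit Arguments.
Unset Strict Implicit.
Unset Printing Implicit Defensive.

Import Order.TTheory GRing.Theory Num.Theory.
Import numFieldTopology.Exports.

Local Open Scope classical_set_scope.
Local Open Scope ring_scope.

(* Values in {0, 1, 2, ...} together with infinity are rendered by [option nat],
   [None] being infinity. *)
Definition least_nat (P : nat -> Prop) : option nat :=
  if pselect (exists k, `[< P k >]) is left exP then Some (ex_minn exP)
  else None.

Lemma least_nat_SomeP (P : nat -> Prop) (k : nat) :
  least_nat P = Some k <-> P k /\ forall m, P m -> (k <= m)%N.
Proof.
rewrite /least_nat; case: pselect => [exP|nexP]; last first.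
  by split=> // -[Pk _]; case: nexP; exists k; apply/asboolP.
case: ex_minnP => m /asboolP Pm minm; split=> [[<-]|[Pk mink]].
  by split=> // j Pj; apply/minm/asboolP.
by congr Some; apply/eqP; rewrite eqn_leq mink// minm//; exact/asboolP.
Qed.

Lemma least_nat_NoneP (P : nat -> Prop) :
  least_nat P = None <-> forall k, ~ P k.
Proof.
rewrite /least_nat; case: pselect => [exP|nexP]; split=> // h.
  by exfalso; case: exP => k /asboolP; exact: h.
by move=> k Pk; apply: nexP; exists k; apply/asboolP.
Qed.

Definition open_cover (X : topologicalType) (k : nat)
    (U : 'I_k.+1 -> set X) : Prop :=
  (forall j, open (U j)) /\ \bigcup_j U j = [set: X].

Section interval_and_wedge.
Context (R : realType).

Definition unit_interval : Type := set_type `[0 : R, 1]%classic.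

HB.instance Definition _ := Topological.on unit_interval.

Lemma unit_interval0_subproof : (0 : R) \in `[0 : R, 1]%classic.
Proof. by rewrite inE /= in_itv /= lexx ler01. Qed.

Lemma unit_interval1_subproof : (1 : R) \in `[0 : R, 1]%classic.
Proof. by rewrite inE /= in_itv /= lexx ler01. Qed.

Definition unit_interval0 : unit_interval :=
  exist _ 0 unit_interval0_subproof.
Definition unit_interval1 : unit_interval :=
  exist _ 1 unit_interval1_subproof.

(* For [n = 0] this is the empty space, not a point: [J_n] is only meaningful
   for [0 < n]. *)
Definition J (n : nat) : Type :=
  wedge (fun _ : 'I_n => unit_interval0).

HB.instance Definition _ n := Topological.on (J n).

Definition J_end (n : nat) (i : 'I_n) : J n :=
  wedge_lift (fun _ : 'I_n => unit_interval0) (i := i) unit_interval1.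

Definition homotopic (A Y : topologicalType) (f g : A -> Y) : Prop :=
  exists H : A * unit_interval -> Y,
    [/\ continuous H,
        forall a, H (a, unit_interval0) = f a
      & forall a, H (a, unit_interval1) = g a].

End interval_and_wedge.

Arguments unit_interval0 {R}.
Arguments unit_interval1 {R}.

Definition mapping_space (A B : topologicalType) : Type := continuousType A B.

HB.instance Definition _ (A B : topologicalType) :=
  Topological.copy (mapping_space A B)
    (initial_topology
       (fun g : continuousType A B => (g : {compact-open, A -> B}))).

Definition endpoint_eval (R : realType) (n : nat) (Y : topologicalType)
    (g : mapping_space (J R n) Y) : prod_topology (fun _ : 'I_n => Y) :=
  fun i => (g : continuousType (J R n) Y) (J_end R i).
Arguments endpoint_eval : clear implicits.

Definition pullback (A B C : topologicalType) (f : A -> C) (e : B -> C) : Type :=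
  set_type [set ab : A * B | e ab.2 = f ab.1].

HB.instance Definition _ (A B C : topologicalType) (f : A -> C) (e : B -> C) :=
  Topological.on (pullback f e).

Definition pullback_fst (A B C : topologicalType) (f : A -> C) (e : B -> C)
    (p : pullback f e) : A := (\val p).1.
Arguments pullback_fst {A B C} f e p.

Definition joint_map (n : nat) (X Y : topologicalType) (f : 'I_n -> X -> Y) :
    X -> prod_topology (fun _ : 'I_n => Y) :=
  fun x i => f i x.

(* The chain [f_1|U ~ f_2|U ~ ... ~ f_n|U] is read literally, as a homotopy
   between each map and the next one. *)
Definition homotopic_distance (R : realType) (n : nat) (X Y : topologicalType)
    (f : 'I_n -> X -> Y) : option nat :=
  least_nat (fun k => exists U : 'I_k.+1 -> set X,
    open_cover U /\
    forall (j : 'I_k.+1) (i i' : 'I_n), i' = i.+1 :> nat ->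
      homotopic R (fun x : set_type (U j) => f i (\val x))
                  (fun x : set_type (U j) => f i' (\val x))).

Definition has_local_section (E B : topologicalType) (q : E -> B)
    (U : set B) : Prop :=
  exists s : set_type U -> E, continuous s /\ forall x, q (s x) = \val x.

Definition secat (E B : topologicalType) (q : E -> B) : option nat :=
  least_nat (fun k => exists U : 'I_k.+1 -> set B,
    open_cover U /\ forall j, has_local_section q (U j)).

(* Main.v *)
(** A section of [q] over [U] is a family of paths in [Y], one for each [x] in
    [U] and each leg of [J_n], which all start at a common centre [c x] and end
    at [f_i x]. Since [0,1] is compact Hausdorff, restricting to the [i]-th leg
    and uncurrying gives a homotopy from [c] to [f_i], so the [f_i] are pairwise
    homotopic on [U]. Conversely, homotopies from [f_1] to the [f_i] on [U] glue
    to a continuous map [U * J_n -> Y], because [U * J_n] is a finite union of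
    closed legs, onto each of which it retracts; its transpose is a section. *)

Require Import Defs.
From HB Require Import structures.
From mathcomp Require Import all_boot all_order all_algebra.
From mathcomp Require Import mathcomp_extra boolp classical_sets functions reals
  topology.
From mathcomp Require Import normedtype wedge_sigT.
From mathcomp Require Import lra.

Set Implicit Arguments.
Unset Strict Implicit.
Unset Printing Implicit Defensive.

Import Order.TTheory GRing.Theory Num.Theory.
Import numFieldTopology.Exports numFieldNormedType.Exports.

Local Open Scope classical_set_scope.
Local Open Scope ring_scope.

(** * Continuity of pairs and composites, and pasting over closed sets *)

Lemma continuous_pair (S T1 T2 : topologicalType) (f : S -> T1) (g : S -> T2) :
  continuous f -> continuous g -> continuous (fun x => (f x, g x)).
Proof. by move=> cf cg x; apply: cvg_pair; [exact: cf|exact: cg]. Qed.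

Lemma continuous_comp_global (S T V : topologicalType) (f : S -> T)
  (g : T -> V) : continuous f -> continuous g -> continuous (g \o f).
Proof. by move=> cf cg x; apply: continuous_comp; [exact: cf|exact: cg]. Qed.

Lemma continuous_fst (S T : topologicalType) : continuous (@fst S T).
Proof. by move=> x; exact: cvg_fst. Qed.

Lemma continuous_snd (S T : topologicalType) : continuous (@snd S T).
Proof. by move=> x; exact: cvg_snd. Qed.

(** Near [x], a piece containing [x] is controlled by the continuity of [g i], and a closed piece
    missing [x] misses a whole neighbourhood; finitely many neighbourhoods are then intersected.
    Each [g i] is defined on all of [T], so no subspace topology enters. *)
Lemma pasting_finite (I : finType) (T Y : topologicalType) (C : I -> set T)
    (g : I -> T -> Y) (f : T -> Y) :
  (forall i, closed (C i)) -> (forall x, exists i, C i x) ->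
  (forall i, continuous (g i)) -> (forall i x, C i x -> f x = g i x) ->
  continuous f.
Proof.
move=> clC covC cg fg x V Vfx; rewrite !nbhs_simpl /=.
have near_i i : \forall y \near x, C i y -> V (f y).
  have [Cx|nCx] := pselect (C i x).
    have : nbhs x (g i @^-1` V) by apply: cg; rewrite -fg.
    by apply: filterS => y Vgy Cy; rewrite (fg i).
  have : nbhs x (~` C i).
    by apply: open_nbhs_nbhs; split=> //; exact: closed_openC.
  by apply: filterS => y nCy /nCy.
have : \forall y \near x, forall i, C i y -> V (f y).
  exact: (@filter_forall _ _ _ (nbhs x) _ near_i).
apply: filterS => y CV.
by have [i Ciy] := covC y; exact: CV Ciy.
Qed.

Lemma injective_hausdorff (S T : topologicalType) (f : S -> T) :
  continuous f -> injective f -> hausdorff_space T -> hausdorff_space S.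
Proof.
move=> cf injf hT x y clxy; apply/injf/hT => A B fxA fyB.
have [z [Az Bz]] := clxy _ _ (cf x A fxA) (cf y B fyB).
by exists (f z).
Qed.

(** * The unit interval as a compact Hausdorff space *)

Section unit_interval_facts.
Context (R : realType).
Local Notation I := (unit_interval R).

Lemma unit_interval_val_continuous : continuous (\val : I -> R).
Proof. exact: initial_continuous. Qed.

Lemma unit_interval_itv (t : I) : 0 <= \val t <= 1.
Proof. by have := valP t; rewrite inE /= in_itv. Qed.

Lemma clamp_subproof (x : R) :
  Num.max 0 (Num.min 1 x) \in `[0 : R, 1]%classic.
Proof.
by rewrite inE /= in_itv /= le_max lexx /= ge_max ler01 /= ge_min lexx.
Qed.

(** The retraction of the line onto the interval: reparametrisations of homotopies can be written as
    real formulas, without proofs that they stay in the interval. *)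
Definition clamp (x : R) : I :=
  exist _ (Num.max 0 (Num.min 1 x)) (clamp_subproof x).

Lemma clampE (t : I) (x : R) : \val t = x -> clamp x = t.
Proof.
move=> <-; have /andP[t0 t1] := unit_interval_itv t.
by apply: val_inj; rewrite /= min_r// max_r.
Qed.

Lemma clamp_le0 (x : R) : x <= 0 -> clamp x = unit_interval0.
Proof.
move=> x0; apply: val_inj => /=.
by rewrite min_r ?max_l// (le_trans x0).
Qed.

Lemma clamp_ge1 (x : R) : 1 <= x -> clamp x = unit_interval1.
Proof. by move=> x1; apply: val_inj => /=; rewrite min_l// max_r. Qed.

Lemma clamp_continuous : continuous clamp.
Proof.
apply: continuous_comp_initial => x /=.
apply: (@continuous_max R R (fun=> 0) (fun y => Num.min 1 y)).
  exact: cvg_cst.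
apply: (@continuous_min _ _ (fun=> 1) id); first exact: cvg_cst.
exact: cvg_id.
Qed.

Lemma unit_interval_compact : compact [set: I].
Proof.
have -> : [set: I] = clamp @` `[0 : R, 1]%classic.
  rewrite eqEsubset; split=> // t _; exists (\val t); last exact: clampE.
  by rewrite /= in_itv /= unit_interval_itv.
apply: continuous_compact; last exact: segment_compact.
exact/continuous_subspaceT/clamp_continuous.
Qed.

Lemma unit_interval_hausdorff : hausdorff_space I.
Proof.
exact: injective_hausdorff unit_interval_val_continuous val_inj (@Rhausdorff R).
Qed.

Lemma unit_interval_locally_compact : locally_compact [set: I].
Proof.
move=> t _; exists setT; first by rewrite withinET; exact: filterT.
by split; [exact: unit_interval_compact|exact: closedT].
Qed.

Lemma closed_set1_unit_interval (t : I) : closed [set t].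
Proof.
apply: accessible_closed_set1.
exact/hausdorff_accessible/unit_interval_hausdorff.
Qed.

End unit_interval_facts.

(** * Homotopy as an equivalence relation *)

Section homotopic_equivalence.
Context (R : realType) (A Y : topologicalType).
Implicit Types f g h : A -> Y.

Lemma homotopic_refl f : continuous f -> homotopic R f f.
Proof.
move=> cf; exists (f \o fst); split=> //.
exact: continuous_comp_global (@continuous_fst _ _) cf.
Qed.

Lemma homotopic_sym f g : homotopic R f g -> homotopic R g f.
Proof.
case=> H [cH H0 H1]; exists (fun p => H (p.1, clamp (1 - \val p.2))); split.
- apply: continuous_comp_global cH; apply: continuous_pair.
    exact: continuous_fst.
  apply: continuous_comp_global (@clamp_continuous R) => p.
  apply: cvgB; first exact: cvg_cst.
  exact: continuous_comp_global (@continuous_snd _ _)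
    (@unit_interval_val_continuous R) p.
- by move=> a; rewrite clamp_ge1 ?H1//= subr0.
- by move=> a; rewrite clamp_le0 ?H0//= subrr.
Qed.

Lemma homotopic_trans f g h :
  homotopic R f g -> homotopic R g h -> homotopic R f h.
Proof.
case=> H [cH H0 H1] [K [cK K0 K1]].
have cval : continuous (fun p : A * unit_interval R => \val p.2).
  exact: continuous_comp_global (@continuous_snd _ _)
    (@unit_interval_val_continuous R).
(* Thanks to [clamp], both halves of the concatenation are continuous on the whole cylinder, as
   [pasting_finite] demands. *)
pose G1 (p : A * unit_interval R) := H (p.1, clamp (2 * \val p.2)).
pose G2 (p : A * unit_interval R) := K (p.1, clamp (2 * \val p.2 - 1)).
pose G (p : A * unit_interval R) := if \val p.2 <= 2^-1 then G1 p else G2 p.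
exists G; split.
- pose C b : set (A * unit_interval R) :=
    [set p | if b then \val p.2 <= 2^-1 else 2^-1 <= \val p.2].
  apply: (@pasting_finite bool _ _ C (fun b => if b then G1 else G2)).
  + have closed_val (D : set R) : closed D ->
        closed ((fun p : A * unit_interval R => \val p.2) @^-1` D).
      by move=> cD; apply: preimage_closed => // p _; exact: cval.
    case; first exact (closed_val [set x | x <= 2^-1] (@closed_le _ _)).
    exact (closed_val [set x | 2^-1 <= x] (@closed_ge _ _)).
  + by move=> p; have [|/ltW] := leP (\val p.2) 2^-1; [exists true|exists false].
  + have cdouble : continuous (fun p : A * unit_interval R => 2 * \val p.2).
      by move=> p; apply: cvgM; [exact: cvg_cst|exact: cval].
    case.
      apply: continuous_comp_global cH; apply: continuous_pair.
        exact: continuous_fst.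
      exact: continuous_comp_global cdouble (@clamp_continuous R).
    apply: continuous_comp_global cK; apply: continuous_pair.
      exact: continuous_fst.
    apply: continuous_comp_global (@clamp_continuous R) => p.
    by apply: cvgB; [exact: cdouble|exact: cvg_cst].
  + case=> -[a t] /=; rewrite /C /G /=; first by move->.
    move=> half_le; case: ifPn => // le_half.
    (* Overlap of the two halves: at time 1/2 both [G1] and [G2] give [g a]. *)
    have tE : \val t = 2^-1 by apply/le_anti/andP.
    by rewrite /G1 /G2 /= clamp_ge1 ?clamp_le0 ?H1 ?K0//= tE; lra.
- by move=> a; rewrite /G /= invr_ge0 ler0n /G1 clamp_le0 ?H0//= mulr0.
- move=> a; rewrite /G /= ifF; last by apply/negbTE; rewrite -ltNge; lra.
  by rewrite /G2 clamp_ge1 ?K1//=; lra.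
Qed.

End homotopic_equivalence.

(** Induction on the index; continuity of [g i0] supplies the constant homotopy of the base case. *)
Lemma homotopic_chain (R : realType) (n : nat) (A Y : topologicalType)
    (g : 'I_n -> A -> Y) (i0 : 'I_n) :
  i0 = 0 :> nat -> continuous (g i0) ->
  (forall i i' : 'I_n, i' = i.+1 :> nat -> homotopic R (g i) (g i')) ->
  forall i, homotopic R (g i0) (g i).
Proof.
move=> i00 cg0 chain [k kn]; elim: k => [|k IH] in kn *.
  by rewrite (_ : Ordinal kn = i0); [exact: homotopic_refl|exact: val_inj].
exact: homotopic_trans (IH (ltnW kn)) (chain _ _ _).
Qed.

(** * Maps out of a wedge, with a parameter *)

(** Inside the product, the wedge appears as the union of the coordinate axes. *)
Lemma wedge_prod_lift (I : choiceType) (X : I -> topologicalType)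
    (p0 : forall i, X i) (i : I) (x : X i) :
  wedge_prod (wedge_lift p0 x) = dfwith p0 i x.
Proof. by rewrite /wedge_prod wedge_lift_funE//; exact: wedge_prod_pointE. Qed.

(* A product with [U] need not preserve quotient maps, so continuity is checked
   on the finite closed cover of the wedge by its legs: the [i]-th leg is where
   the coordinates [j != i] of [wedge_prod] sit at the base point, and the
   [i]-th coordinate retracts the wedge onto it. *)
Lemma wedge_fun_param_continuous (I : finType) (X : I -> topologicalType)
    (p0 : forall i, X i) (U Y : topologicalType) (G : forall i, U * X i -> Y) :
  (forall i, closed [set p0 i]) -> (forall i, continuous (G i)) ->
  (forall u i j, G i (u, p0 i) = G j (u, p0 j)) ->
  continuous (fun p : U * wedge p0 =>
    wedge_fun (fun i t => G i (p.1, t)) p.2).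
Proof.
move=> clp0 cG G0.
have cproj j : continuous (fun p : U * wedge p0 => wedge_prod p.2 j).
  have cprod : continuous (fun z : wedge p0 => wedge_prod z j).
    exact: continuous_comp_global (@wedge_prod_continuous _ _ p0)
      (@proj_continuous _ _ j).
  exact: continuous_comp_global (@continuous_snd _ _) cprod.
pose C i : set (U * wedge p0) :=
  \bigcap_(j in [set j | j != i])
    ((fun p => wedge_prod p.2 j) @^-1` [set p0 j]).
have liftP z : exists i (x : X i), z = wedge_lift p0 x.
  have : [set: wedge p0] z by [].
  by rewrite -wedgeTE => -[i _ [x _ <-]]; exists i, x.
apply: (pasting_finite (C := C)
    (g := fun i p => G i (p.1, wedge_prod p.2 i))).
- move=> i; apply: closed_bigI => j _.
  by apply: preimage_closed => // p _; exact: cproj.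
- move=> [u z]; have [i [x ->]] := liftP z; exists i => j /= ji.
  by rewrite wedge_prod_lift dfwithout// eq_sym.
- move=> i; apply: continuous_comp_global (cG i).
  by apply: continuous_pair; [exact: continuous_fst|exact: cproj].
- move=> i [u z]; have [k [x ->]] := liftP z => /= Ci.
  rewrite wedge_lift_funE// wedge_prod_lift.
  have [ik|ki] := eqVneq k i; first by subst k; rewrite dfwithin.
  (* A point of leg [k] that also lies in [C i] has [x = p0 k], so it is the base point, where [G0]
     identifies the values. *)
  have := Ci k ki; rewrite /= wedge_prod_lift dfwithin => ->.
  by rewrite dfwithout// (G0 u k i).
Qed.

(** * Restriction of maps to the legs of [J R n] *)

Lemma compact_open_precomp_continuous (S T Y : topologicalType) (h : S -> T) :
  continuous h ->
  continuous (fun g : {compact-open, T -> Y} =>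
    (g \o h : {compact-open, S -> Y})).
Proof.
move=> ch g; apply/compact_open_cvgP.
  by apply: fmap_filter; exact: nbhs_filter.
move=> K O cK oO ghKO.
have chK : compact (h @` K).
  by apply: continuous_compact => //; exact: continuous_subspaceT.
have oS := @compact_open_open T Y (h @` K) O chK oO.
have gS : g @` (h @` K) `<=` O.
  by move=> _ [_ [t Kt <-] <-]; apply: ghKO; exists t.
apply: filterS (open_nbhs_nbhs (conj oS gS)) => g' g'S _ [t Kt <-].
by apply: g'S; exists (h t) => //; exists t.
Qed.

Definition J_leg (R : realType) (n : nat) (i : 'I_n) :
    unit_interval R -> J R n :=
  wedge_lift (fun _ : 'I_n => unit_interval0) (i := i).
Arguments J_leg R {n} i _.

Lemma J_leg_continuous (R : realType) (n : nat) (i : 'I_n) :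
  continuous (J_leg R i).
Proof.
exact (@wedge_lift_continuous _ _ (fun _ : 'I_n => @unit_interval0 R) i).
Qed.

Lemma J_leg0 (R : realType) (n : nat) (i j : 'I_n) :
  J_leg R i unit_interval0 = J_leg R j unit_interval0.
Proof.
exact (@wedge_liftE _ _ (fun _ : 'I_n => @unit_interval0 R)
  j unit_interval0 i unit_interval0).
Qed.

(** * Local sections against homotopies *)

Section sections_and_homotopies.
Context (R : realType) (n : nat) (X Y : topologicalType) (f : 'I_n -> X -> Y).
Local Notation I := (unit_interval R).
Local Notation q := (pullback_fst (joint_map f) (endpoint_eval R n Y)).

Lemma local_section_homotopic (U : set X) : has_local_section q U ->
  forall i j, homotopic R (fun x : U => f i (\val x)) (fun x : U => f j (\val x)).
Proof.
move=> [s [cs sK]].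
pose path (x : U) : mapping_space (J R n) Y := (\val (s x)).2.
(* [mapping_space] carries the initial topology of its inclusion into the compact-open space, so
   that inclusion is continuous. *)
have cpath : continuous (fun x => path x : {compact-open, J R n -> Y}).
  apply: (@continuous_comp_global _ _ _ path
    (fun g : mapping_space (J R n) Y => g : {compact-open, J R n -> Y})).
    apply: (@continuous_comp_global _ _ _ s (fun z => (\val z).2)) => //.
    apply: (@continuous_comp_global _ _ _
      (\val : pullback (joint_map f) (endpoint_eval R n Y) -> _) snd).
      exact: initial_continuous.
    exact: continuous_snd.
  exact: initial_continuous.
have clift (i : 'I_n) : continuous (J_leg R i) by exact: J_leg_continuous.
(* Restricting to a leg before uncurrying means that local compactness is asked of the interval
   only, not of [J R n]. *)
pose leg i (x : U) : I -> Y := path x \o J_leg R i.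
have cleg i : continuous (uncurry (leg i)).
  apply: continuous_uncurry.
  - exact: unit_interval_locally_compact.
  - exact: unit_interval_hausdorff.
  - apply: (@continuous_comp_global _ _ _
        (fun x => path x : {compact-open, J R n -> Y})
        (fun g => g \o J_leg R i : {compact-open, I -> Y})) => //.
    by apply: compact_open_precomp_continuous; exact: clift.
  - move=> x; apply: (@continuous_comp_global _ _ _ (J_leg R i)
      (path x : continuousType (J R n) Y)); first exact: clift.
    exact: cts_fun.
have leg1 i x : leg i x unit_interval1 = f i (\val x).
  have endE : endpoint_eval R n Y (path x) = joint_map f (q (s x)).
    by have := valP (s x); rewrite inE.
  exact: etrans (congr1 (@^~ i) endE) (congr1 (f i) (sK x)).
have leg0 i j x : leg i x unit_interval0 = leg j x unit_interval0.
  by congr (path x _); exact: J_leg0.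
(* Run leg [i] backwards from [f i] to the common centre, then leg [j] out to [f j]. *)
move=> i j; apply: (@homotopic_trans _ _ _ _ (fun x => leg i x unit_interval0)).
  apply: homotopic_sym; exists (uncurry (leg i)); split=> // x.
  exact: leg1.
exists (uncurry (leg j)); split=> // x; first exact: leg0.
exact: leg1.
Qed.

Lemma homotopic_local_section (U : set X) (i0 : 'I_n) :
  (forall i, homotopic R (fun x : U => f i0 (\val x))
                         (fun x : U => f i (\val x))) ->
  has_local_section q U.
Proof.
move=> /choice[H HP].
have cH i : continuous (H i) by have [] := HP i.
have H0 i x : H i (x, unit_interval0) = f i0 (\val x) by have [] := HP i.
have H1 i x : H i (x, unit_interval1) = f i (\val x) by have [] := HP i.
(* All [H i] start at [f i0], so they agree at the wedge point, and [f i0] becomes the centre of the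
   star. *)
pose glued (p : U * J R n) : Y := wedge_fun (fun i t => H i (p.1, t)) p.2.
have cglued : continuous glued.
  apply: wedge_fun_param_continuous => // [i|u i j].
    exact: closed_set1_unit_interval.
  by rewrite !H0.
have [ccurry cpath] := continuous_curry cglued.
pose path (x : U) : mapping_space (J R n) Y :=
  HB.pack_for (continuousType (J R n) Y) (curry glued x)
    (isContinuous.Build _ _ (curry glued x) (cpath x)).
have pathP (x : U) :
    (\val x, path x) \in [set xg | endpoint_eval R n Y xg.2 = joint_map f xg.1].
  rewrite inE /=; apply/funext => i.
  (* The final [H0] discharges the agreement at the base point that [wedge_lift_funE] asks for. *)
  by rewrite /endpoint_eval /= /curry /glued /= wedge_lift_funE// => *; rewrite !H0.
exists (fun x => exist _ (\val x, path x) (pathP x)); split=> //.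
have cval : continuous (\val : U -> X) by exact: initial_continuous.
have cpath' : continuous path by exact: continuous_comp_initial.
apply: continuous_comp_initial.
exact: continuous_pair cval cpath'.
Qed.

End sections_and_homotopies.

(** * Equality of the two invariants *)

Theorem theorem3p5 (R : realType) (n : nat) (n_gt0 : (0 < n)%N)
    (X Y : topologicalType) (f : 'I_n -> X -> Y)
    (f_cont : forall i : 'I_n, continuous (f i)) :
  homotopic_distance R f
  = secat (pullback_fst (joint_map f) (endpoint_eval R n Y)).
Proof.
(* For each [k] the same open cover serves both sides. *)
congr least_nat; apply/funext => k; apply/propext.
split=> -[U [covU UP]]; exists U; split=> // j.
  (* Positivity of [n] provides a first map, from which the chain of consecutive homotopies reaches
     all the others. *)
  apply: (@homotopic_local_section _ _ _ _ _ _ (Ordinal n_gt0)).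
  apply: homotopic_chain => //; last exact: UP.
  have cval : continuous (\val : U j -> X) by exact: initial_continuous.
  exact: continuous_comp_global cval (f_cont _).
by move=> i i' _; apply: local_section_homotopic.
Qed.
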